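(* Let $L\subseteq\Sigma^*$ be a regular language and let $\mathscr{A}_L$ be the minimal DFA recognizing $L$. The automaton $\mathscr{A}_L$ is synchronizing and $L\cap\mathrm{Syn}(\mathscr{A}_L)\neq\emptyset$ if and only if the following two properties hold: (i) $C(L)\neq\emptyset$; (ii) $\overline{L}$ does not contain right ideals.
   Context: $\Sigma$ is a finite non-empty alphabet. DFAs have totally defined transition functions, so $\mathscr{A}_L$ is the complete minimal DFA. A word $u$ is reset for a DFA with state set $Q$ and transition function $\delta$ if $\delta(q,u)=\delta(q',u)$ for all $q,q'\in Q$; $\mathrm{Syn}(\mathscr{A})$ is the set of reset words of $\mathscr{A}$, and $\mathscr{A}$ is synchronizing if $\mathrm{Syn}(\mathscr{A})\neq\emptyset$. A word $w\in\Sigma^*$ is a constant for $L$ if for all $u_1,u_2,u_3,u_4\in\Sigma^*$, $u_1wu_2\in L$ and $u_3wu_4\in L$ imply $u_1wu_4\in L$; $C(L)$ is the set of all constants of $L$. $\overline{L}=\Sigma^*\setminus L$. A right ideal is a non-empty language $R\subseteq\Sigma^*$ with $R\Sigma^*\subseteq R$. *)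

(* Defs.v *)
From HB Require Import structures.
From mathcomp Require Import all_boot all_classical.

Set Implicit Arguments.
Unset Strict Implicit.
Unset Printing Implicit Defensive.

Local Open Scope classical_set_scope.

Notation language Sigma := (set (seq Sigma)).

(* Transition functions are total, so every automaton is complete. *)
Record dfa (Sigma : finType) := DFA {
  state : finType;
  start : state;
  final : {set state};
  trans : state -> Sigma -> state
}.

Section Automata.
Variable Sigma : finType.
Implicit Types (A B : dfa Sigma) (L R : language Sigma).

Definition delta A (q : state A) (w : seq Sigma) : state A :=
  foldl (@trans Sigma A) q w.

Definition lang A : language Sigma :=
  [set w | delta (start A) w \in final A].

Definition regular L : Prop := exists A, lang A = L.

(* The minimal automaton of a language is unique up to isomorphism only, so
   minimality is a predicate; B ranges over complete automata. *)
Definition minimal_dfa L A : Prop :=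
  lang A = L /\ forall B, lang B = L -> #|state A| <= #|state B|.

Definition Syn A : language Sigma :=
  [set u | forall q q' : state A, delta q u = delta q' u].

Definition synchronizing A : Prop := Syn A !=set0.

Definition constants L : language Sigma :=
  [set w | forall u1 u2 u3 u4 : seq Sigma,
     L (u1 ++ w ++ u2) -> L (u3 ++ w ++ u4) -> L (u1 ++ w ++ u4)].

Definition right_ideal R : Prop :=
  R !=set0 /\ forall u v : seq Sigma, R u -> R (u ++ v).

End Automata.

(* Main.v *)
Require Import Defs.
From HB Require Import structures.
From mathcomp Require Import all_boot all_classical.

Set Implicit Arguments.
Unset Strict Implicit.
Unset Printing Implicit Defensive.

Local Open Scope classical_set_scope.

(** In the minimal automaton all states are reachable and equivalent states are
equal. If [w] is a constant and every word extends into [L], then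
[u1 ++ w] and [u2 ++ w] have the same residual for all [u1] and [u2], so [w] is
reset, and any extension of [w] in [L] is reset too. Conversely, a reset word
in [L] is a constant, and appending it to any word gives a word of [L]. *)

Section MinimalAutomata.
Variable Sigma : finType.
Implicit Types (A B : dfa Sigma) (L : language Sigma) (u v w : seq Sigma).

Lemma delta_cat A (q : state A) u v : delta q (u ++ v) = delta (delta q u) v.
Proof. exact: foldl_cat. Qed.

Lemma langE A u : lang A u = (delta (start A) u \in final A).
Proof. by []. Qed.

(* [c] need not be a right congruence: the automaton on the values of [c] steps
   from a representative word of each value, and its state after [u] is the
   value of some word that has the same residual as [u]. *)
Lemma minimal_dfa_card L A (T : finType) (P : {pred T}) (c : seq Sigma -> T) :
    minimal_dfa L A -> (forall u, c u \in P) ->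
    (forall u v, c u = c v -> forall w, L (u ++ w) <-> L (v ++ w)) ->
  #|state A| <= #|P|.
Proof.
move=> [_ minA] cP cL.
pose S : finType := {x | x \in P}.
pose d u : S := exist _ (c u) (cP u).
(* The default [[::]] is taken only at elements of [S] that label no word, and runs of [B] never
   visit these. *)
pose r (t : S) := xget [::] [set u | d u = t].
pose B := @DFA Sigma S (d [::]) [set t | `[< L (r t) >]]%SET
  (fun t a => d (rcons (r t) a)).
have rL u w : L (r (d u) ++ w) <-> L (u ++ w).
  have /(congr1 val) du : d (r (d u)) = d u.
    by apply: (@xgetPex _ [::] [set v | d v = d u]); exists u.
  exact: cL.
have runB u : exists2 v, delta (start B) u = d v &
    forall w, L (v ++ w) <-> L (u ++ w).
  elim/last_ind: u => [|u a [v run_v vL]]; first by exists [::].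
  exists (rcons (r (d v)) a) => [|w].
    by rewrite -cats1 delta_cat run_v.
  by rewrite !cat_rcons rL.
suff /minA : lang B = L by rewrite [X in _ <= X -> _]card_sig.
apply/seteqP; suff langB u : lang B u <-> L u by split=> u /langB.
have [v run_v vL] := runB u.
have := rL v [::]; have := vL [::]; rewrite !cats0 => <- <-.
by rewrite langE run_v inE; split=> /asboolP.
Qed.

(** Label each word by the state it reaches: the labels fill only the reachable states, so by
    minimality these are all the states. *)
Lemma minimal_dfa_reachable L A (q : state A) :
  minimal_dfa L A -> exists u, delta (start A) u = q.
Proof.
move=> minA; have [LA _] := minA.
pose P := [pred p : state A | `[< exists u, delta (start A) u = p >]].
have : #|state A| <= #|P|.
  apply: (minimal_dfa_card (c := delta (start A)) minA) => [u|u v uv w].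
    by apply/asboolP; exists u.
  by rewrite -LA !langE !delta_cat uv.
move=> le_P; have /subset_cardP/(_ (subset_predT _))/(_ q) : #|P| = #|state A|.
  by apply/eqP; rewrite eqn_leq max_card.
by rewrite !inE => /asboolP.
Qed.

(** If [p] and [q] were distinct, the state reached by a word, with [q] replaced by [p], would still
    determine the residual of the word while never being [q], against minimality. *)
Lemma minimal_dfa_separated L A (p q : state A) : minimal_dfa L A ->
  (forall w, (delta p w \in final A) = (delta q w \in final A)) -> p = q.
Proof.
move=> minA pq; have [LA _] := minA; apply/eqP; apply: contraT => p_neq_q.
pose f x := if x == q then p else x.
have f_final x w : (delta (f x) w \in final A) = (delta x w \in final A).
  by rewrite /f; case: eqP => [->|].
suff : #|state A| <= #|predC1 q| by rewrite cardC1 leqNgt ltn_predL (cardD1 q).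
apply: (minimal_dfa_card (c := f \o delta (start A)) minA) => [u|u v /= uv w].
  by rewrite inE /= /f; case: ifP => // ->.
by rewrite -LA !langE !delta_cat -f_final uv f_final.
Qed.

Lemma Syn_cat A u v : Syn A u -> Syn A (u ++ v).
Proof. by move=> uS q q'; rewrite !delta_cat (uS q q'). Qed.

Lemma Syn_constants A : Syn A `<=` constants (lang A).
Proof.
move=> w wS u1 u2 u3 u4 _; rewrite !langE !delta_cat.
by rewrite (wS _ (delta (start A) u1)).
Qed.

Lemma constants_Syn L A : minimal_dfa L A ->
  (forall u, exists v, L (u ++ v)) -> constants L `<=` Syn A.
Proof.
move=> minA extL w wC q q'; have [LA _] := minA.
have [[u <-] [u' <-]] := (minimal_dfa_reachable q minA,
                          minimal_dfa_reachable q' minA).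
(* An extension of [u2 ++ w] into [L] supplies the left context [u2], and the constant [w] lets its
   tail be exchanged for [v]. *)
have transfer u1 u2 v : L (u1 ++ w ++ v) -> L (u2 ++ w ++ v).
  by have [v'] := extL (u2 ++ w); rewrite -catA; apply: wC.
apply: (minimal_dfa_separated minA) => v; rewrite -!delta_cat.
by apply/idP/idP; rewrite -!langE LA; apply: transfer.
Qed.

Lemma no_right_ideal_setC L :
  ~ (exists R : language Sigma, right_ideal R /\ R `<=` ~` L) <->
  forall u, exists v, L (u ++ v).
Proof.
split=> [noR u|extL [R [[[u Ru] Rideal] RL]]]; last first.
  by have [v] := extL u; apply: RL; apply: Rideal.
apply: contrapT => noext; apply: noR.
(* The right ideal generated by a word [u] without extension in [L]. *)
exists [set x | exists v, x = u ++ v]; split.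
  split=> [|_ v [v' ->]]; first by exists u, [::]; rewrite cats0.
  by exists (v' ++ v); rewrite catA.
by move=> _ [v ->] Luv; apply: noext; exists v.
Qed.

End MinimalAutomata.

Theorem proposition5 (Sigma : finType) (Sigma_gt0 : 0 < #|Sigma|)
    (L : language Sigma) (L_regular : regular L)
    (A : dfa Sigma) (A_minimal : minimal_dfa L A) :
  (synchronizing A /\ L `&` Syn A !=set0) <->
  (constants L !=set0 /\
   ~ (exists R : language Sigma, right_ideal R /\ R `<=` ~` L)).
Proof.
rewrite no_right_ideal_setC; have [LA _] := A_minimal.
split=> [[_ [w [Lw wS]]]|[[w wC] extL]].
  split=> [|u]; first by exists w; rewrite -LA; apply: Syn_constants.
  (* The reset word [w] leads to the same final state after [u] as from the start. *)
  exists w; move: Lw; rewrite -LA !langE delta_cat.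
  by rewrite (wS _ (delta (start A) u)).
have wS := constants_Syn A_minimal extL wC; have [v Lwv] := extL w.
by split; [exists w | exists (w ++ v); split=> //; apply: Syn_cat].
Qed.
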